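(* Let $\theta\in(0,2\pi)$, $\xi\in\{\pm1\}$, and let $\psi_n^\xi=W^n\psi_0^\xi$ be the quantum walk on $\mathbb{Z}$ with homogeneous coin $e^{i\theta\sigma_1}$ started from $\psi_0^\xi(x,z)=\mathbf{1}_{\{x=0,\,z=\xi\}}$. Then for every $n\ge 1$, $x\in\mathbb{Z}$ and $z\in\{\pm1\}$, $$\psi_n^\xi(x,z)=\begin{cases}2e^{n\theta}\sum_{j=1}^2 I_n(0,xz;B_j),& z=\xi,\\[2pt] 2i\,e^{n\theta}\sum_{j=1}^2 I_n(1,xz;B_j),& z=-\xi,\end{cases}$$ where the integrals $I_n(s,t;B_j)$, defined in the context, involve only the eigenvalues and eigenvectors of the tilted kernel $P_k$ attached to the invariant subspace $\mathrm{span}\{e_0-e_2,\,e_1-e_3\}$.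
   Context: Quantum walk: on $\ell^2(\mathbb{Z}\times\{\pm1\})\cong\ell^2(\mathbb{Z})\otimes\ell^2(\{\pm1\})$ with orthonormal basis $e_xe_z$ and $\psi=\sum_{x,z}\psi(x,z)e_xe_z$, the walk operator is $W=SC$ with $C=I\otimes e^{i\theta\sigma_1}$, $e^{i\theta\sigma_1}=\begin{bmatrix}\cos\theta&i\sin\theta\\ i\sin\theta&\cos\theta\end{bmatrix}$ in the ordered basis $(e_1,e_{-1})$, and $Se_xe_z=e_{x+z}e_z$. Tilted kernel: let $\Omega=\{0,1,2,3\}$, with $p_0=\tfrac{e^{-\theta}}2(\cosh\theta+\cos\theta)$, $p_1=\tfrac{e^{-\theta}}2(\sinh\theta+\sin\theta)$, $p_2=\tfrac{e^{-\theta}}2(\cosh\theta-\cos\theta)$, $p_3=\tfrac{e^{-\theta}}2(\sinh\theta-\sin\theta)$ (so $p_s=\mathbb{P}(N\equiv s \bmod 4)$ for $N$ Poisson($\theta$)). For $k\in(-\pi,\pi)$, $P_k$ is the $4\times4$ matrix indexed by $\Omega$ with entries $P_k(s',s)=e^{ik(-1)^{s'}}p_{(s-s')\bmod 4}$. (It is the Fourier-tilted transition matrix of the chain $S_n=N_1+\dots+N_n\bmod 4$, $N_j$ i.i.d. Poisson($\theta$), paired with $T_n=\sum_{j=0}^{n-1}(-1)^{S_j}$.) The subspace $\mathrm{span}\{e_0-e_2,e_1-e_3\}$ of $\mathbb{C}^4$ is invariant under $P_k$, and on it $P_k$ is represented by $B(k)=e^{-\theta}\begin{bmatrix}e^{ik}\cos\theta&e^{ik}\sin\theta\\-e^{-ik}\sin\theta&e^{-ik}\cos\theta\end{bmatrix}$,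 with eigenvalues $$\lambda_{B,1}(k)=e^{-\theta}\big[\cos k\cos\theta+i\sqrt{1-\cos^2k\cos^2\theta}\big],\qquad \lambda_{B,2}(k)=e^{-\theta}\big[\cos k\cos\theta-i\sqrt{1-\cos^2k\cos^2\theta}\big].$$ For every $k\in(-\pi,\pi)$ with $\lambda_{B,1}(k)\ne\lambda_{B,2}(k)$ (all $k$ except at most one), let $r_{B,j}(k)=(r_{B,j}(k,s))_{s\in\Omega}$ be a right eigenvector, $P_kr_{B,j}(k)=\lambda_{B,j}(k)r_{B,j}(k)$, lying in $\mathrm{span}\{e_0-e_2,e_1-e_3\}$, and let $\ell_{B,j}(k)=(\ell_{B,j}(k,s))_{s\in\Omega}$ be a left eigenvector (row vector), $\ell_{B,j}(k)P_k=\lambda_{B,j}(k)\ell_{B,j}(k)$, with $\ell_{B,j}(k,0)=-\ell_{B,j}(k,2)$ and $\ell_{B,j}(k,1)=-\ell_{B,j}(k,3)$, normalized by $\sum_{s\in\Omega}\ell_{B,j}(k,s)r_{B,j}(k,s)=1$. (The products $r_{B,j}(k,0)\ell_{B,j}(k,s)$ do not depend on the choice.) Define for $s\in\Omega$, $t\in\mathbb{Z}$, $j=1,2$: $$I_n(s,t;B_j)=\frac1{2\pi}\int_{-\pi}^{\pi}r_{B,j}(k,0)\,\ell_{B,j}(k,s)\,\lambda_{B,j}(k)^n\,e^{-ikt}\,dk.$$ *)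

(* Defs.v *)
From mathcomp Require Import all_boot all_order all_algebra.
From mathcomp Require Import complex ring lra.
From mathcomp Require Import all_classical all_reals all_analysis.

Set Implicit Arguments.
Unset Strict Implicit.
Unset Printing Implicit Defensive.
Import Order.TTheory GRing.Theory Num.Theory.
Import numFieldNormedType.Exports.
Local Open Scope classical_set_scope.
Local Open Scope ring_scope.
Local Open Scope complex_scope.

(* The coin space has the ordered basis (e_1, e_{-1}): the index 0 : 'I_2
   stands for z = 1 and the index 1 for z = -1. *)
Definition spin (z : 'I_2) : int := (-1) ^+ z.

Definition site := (int * 'I_2)%type.

Definition square_summable (R : realType) (psi : site -> R[i]) : Prop :=
  summable [set: site] (fun p => (Normc.normc (psi p) ^+ 2)%:E).

Record ell2 (R : realType) := Ell2 {
  amplitude :> site -> R[i];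
  ell2P : square_summable amplitude }.

Lemma sqr_normcE (R : realType) (u : R[i]) :
  Normc.normc u ^+ 2 = complex.Re u ^+ 2 + complex.Im u ^+ 2.
Proof. by case: u => a b /=; rewrite sqr_sqrtr// addr_ge0 ?sqr_ge0. Qed.

Lemma ket_subproof (R : realType) (p0 : site) :
  square_summable (fun p : site => (p == p0)%:R : R[i]).
Proof.
rewrite /square_summable /summable.
rewrite (_ : esum _ _ = \esum_(p in [set p0]) 1%E).
  by rewrite esum_set1// ltry.
rewrite [RHS]esum_mkcond; apply: eq_esum => p _.
rewrite sqr_normcE classical_sets.in_set1.
by case: eqP => _ /=; rewrite ?(expr1n, expr0n) /= ?addr0 ?abse1 ?normr1 ?normr0.
Qed.

Definition ket (R : realType) (x : int) (z : 'I_2) : ell2 R :=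
  Ell2 (ket_subproof R (x, z)).

Lemma shift_subproof (R : realType) (psi : ell2 R) :
  square_summable (fun p : site => psi (p.1 - spin p.2, p.2)).
Proof.
have bij : set_bij [set: site] [set: site]
    (fun p : site => (p.1 - spin p.2, p.2)).
  split=> //.
    move=> [x z] [y w] _ _ /= [] + zw; rewrite {}zw => /addIr ->//.
  by move=> [x z] _; exists (x + spin z, z) => //=; rewrite addrK.
rewrite /square_summable /summable
  -(reindex_esum _ _ _ (fun p => `|(Normc.normc (psi p) ^+ 2)%:E|%E) bij).
exact: ell2P psi.
Qed.

(* Coordinate form of S e_x e_z = e_{x+z} e_z; see [walk_shift_ket]. *)
Definition walk_shift (R : realType) (psi : ell2 R) : ell2 R :=
  Ell2 (shift_subproof psi).

Definition coin_mx (R : realType) (theta : R) : 'M[R[i]]_2 :=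
  \matrix_(z, w) if z == w then (cos theta)%:C else (0 +i* sin theta).

Lemma coin_subproof (R : realType) (theta : R) (psi : ell2 R) :
  square_summable
    (fun p : site => \sum_(w < 2) coin_mx theta p.2 w * psi (p.1, w)).
Proof.
pose g (p : site) := (Normc.normc (psi p) ^+ 2)%:E.
pose flip (p : site) : site := (p.1, rev_ord p.2).
have bij : set_bij [set: site] [set: site] flip.
  split=> //.
    by move=> [x z] [y w] _ _ /(congr1 flip); rewrite /flip /= !rev_ordK.
  by move=> [x z] _; exists (x, rev_ord z) => //=; rewrite /flip /= rev_ordK.
have sg : summable [set: site] g := ell2P psi.
have sgf : summable [set: site] (g \o flip).
  by rewrite /summable -(reindex_esum _ _ _ (fun p => `|g p|%E) bij).
have sgg := summableD sg sgf.
apply: le_lt_trans (summableD sgg sgg); apply: le_esum => -[x z] _.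
rewrite /g /flip /=.
have cs := cos2Dsin2 theta.
have z01 : z = 0 \/ z = 1.
  by case: z => [[|[|//]] hz]; [left|right]; exact: val_inj.
have r0 : rev_ord (0 : 'I_2) = 1 by exact: val_inj.
have r1 : rev_ord (1 : 'I_2) = 0 by exact: val_inj.
rewrite lee_fin [leLHS]ger0_norm ?sqr_ge0//.
apply: le_trans (ler_norm _).
have -> (F : 'I_2 -> R[i]) : \sum_(w < 2) F w = F 0 + F 1.
  by rewrite big_ord_recl big_ord1; congr (F _ + F _); exact: val_inj.
rewrite !mxE.
have CS (a d : R) : (cos theta * a - sin theta * d) ^+ 2 <= a ^+ 2 + d ^+ 2.
  rewrite -subr_ge0 -[X in X - _]mul1r -cs.
  by rewrite (_ : _ - _ = (cos theta * d + sin theta * a) ^+ 2) ?sqr_ge0//; ring.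
case: z01 => ->; rewrite ?r0 ?r1 /= !sqr_normcE;
  case: (psi (x, 0)) => a b; case: (psi (x, 1)) => c d /=;
  move: (sin theta) (cos theta) CS => s k CS; simpc => /=;
  have := sqr_ge0 a; have := sqr_ge0 b; have := sqr_ge0 c; have := sqr_ge0 d.
  by have := CS a d; have := CS b (- c); lra.
by have := CS c b; have := CS d (- a); lra.
Qed.

(* The operator I (x) e^{i theta sigma_1}. *)
Definition walk_coin (R : realType) (theta : R) (psi : ell2 R) : ell2 R :=
  Ell2 (coin_subproof theta psi).

Definition walk (R : realType) (theta : R) (psi : ell2 R) : ell2 R :=
  walk_shift (walk_coin theta psi).

Lemma walk_shift_ket (R : realType) (x : int) (z : 'I_2) (p : site) :
  walk_shift (ket R x z) p = ket R (x + spin z) z p.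
Proof.
case: p => y w /=; congr (_%:R); rewrite /= !xpair_eqE.
by case: (w =P z) => [->|_]; rewrite ?andbF ?andbT// subr_eq.
Qed.

Lemma walk_coin_ket (R : realType) (theta : R) (x : int) (z : 'I_2) (p : site) :
  walk_coin theta (ket R x z) p = \sum_(w < 2) coin_mx theta w z * ket R x w p.
Proof.
case: p => y v /=.
rewrite (bigD1 z)//= [RHS](bigD1 v)//= [X in _ + X]big1 ?addr0; last first.
  by move=> w /negbTE wz; rewrite xpair_eqE wz andbF mulr0.
rewrite big1 ?addr0; last first.
  by move=> w /negbTE wv; rewrite xpair_eqE [v == w]eq_sym wv andbF mulr0.
by rewrite !xpair_eqE !eqxx.
Qed.

Definition expi (R : realType) (t : R) : R[i] := cos t +i* sin t.

Definition cosh (R : realType) (t : R) : R := (expR t + expR (- t)) / 2.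
Definition sinh (R : realType) (t : R) : R := (expR t - expR (- t)) / 2.

(* The probability that a Poisson variable of parameter theta is s mod 4. *)
Definition poisson4 (R : realType) (theta : R) (s : 'I_4) : R :=
  expR (- theta) / 2 *
  nth 0 [:: cosh theta + cos theta; sinh theta + sin theta;
            cosh theta - cos theta; sinh theta - sin theta] s.

(* The subtraction [s - s'] is the one of 'I_4 seen as Z/4Z. *)
Definition tilted_kernel (R : realType) (theta k : R) : 'M[R[i]]_4 :=
  \matrix_(s', s) (expi ((-1) ^+ s' * k) * (poisson4 theta (s - s'))%:C).

(* The index j : 'I_2 is shifted by one: j = 0 gives lambda_{B,1} and j = 1
   gives lambda_{B,2}. *)
Definition lambdaB (R : realType) (theta : R) (j : 'I_2) (k : R) : R[i] :=
  (expR (- theta))%:C *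
  ((cos k * cos theta) +i*
   ((-1) ^+ j * Num.sqrt (1 - cos k ^+ 2 * cos theta ^+ 2))).

Definition spanB (R : realType) : {vspace 'cV[R[i]]_4} :=
  <<[:: (delta_mx 0 0 - delta_mx 2 0)%R; (delta_mx 1 0 - delta_mx 3 0)%R]>>%VS.

(* [r j k] and [l j k] are the eigenvectors r_{B,j}(k) and l_{B,j}(k); they are
   unconstrained where the two eigenvalues coincide. *)
Definition eigenvectorsB (R : realType) (theta : R)
    (r : 'I_2 -> R -> 'cV[R[i]]_4) (l : 'I_2 -> R -> 'rV[R[i]]_4) : Prop :=
  forall (k : R), - pi < k < pi -> lambdaB theta 0 k != lambdaB theta 1 k ->
  forall j : 'I_2,
  [/\ r j k != 0 /\ r j k \in spanB R,
      tilted_kernel theta k *m r j k = lambdaB theta j k *: r j k,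
      l j k != 0 /\ (l j k 0 0 = - l j k 0 2 /\ l j k 0 1 = - l j k 0 3),
      l j k *m tilted_kernel theta k = lambdaB theta j k *: l j k
    & \sum_(s < 4) l j k 0 s * r j k s 0 = 1].

Definition Cintegral (R : realType) (D : set R) (f : R -> R[i]) : R[i] :=
  (\int[lebesgue_measure]_(k in D) complex.Re (f k)) +i*
  (\int[lebesgue_measure]_(k in D) complex.Im (f k)).

Definition I_B (R : realType) (theta : R)
    (r : 'I_2 -> R -> 'cV[R[i]]_4) (l : 'I_2 -> R -> 'rV[R[i]]_4)
    (n : nat) (s : 'I_4) (t : int) (j : 'I_2) : R[i] :=
  ((2 * pi)^-1)%:C *
  Cintegral `]- pi, pi[
    (fun k => r j k 0 0 * l j k 0 s * lambdaB theta j k ^+ n *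
              expi (- (k * t%:~R))).

(* Main.v *)
Require Import Defs.
From mathcomp Require Import all_boot all_order all_algebra.
From mathcomp Require Import complex ring lra.
From mathcomp Require Import all_classical all_reals all_analysis.
From mathcomp Require Import measurable_realfun.

Import Order.TTheory GRing.Theory Num.Theory.
Import numFieldNormedType.Exports.
Local Open Scope classical_set_scope.
Local Open Scope ring_scope.
Local Open Scope complex_scope.

(** The walk operator commutes with translations, so the Fourier transform in
    the position variable turns it into multiplication by the 2 x 2 matrix
    [walk_symbol theta k], whose (z, w) entry is exp(i k z) times the coin
    entry, and the amplitudes are the Fourier coefficients of the entries of
    its n-th power ([walk_Fourier]).

    The tilted kernel, restricted to antisymmetric vectors (those for which
    the entry s + 2 is opposite to the entry s), is exp(- theta) B'(k) with
    B'(k) = [[e^{ik} c, e^{ik} s], [- e^{-ik} s, e^{-ik} c]], c = cos theta,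
    s = sin theta. Conjugation by diag(1, - i) takes B'(k) to the symbol of
    the walk. Hence, if l is an antisymmetric left eigenvector of the tilted
    kernel for lambda, then (l_0, i l_1) is a left eigenvector of the symbol
    for e^theta lambda ([spectral_row_eigen]); the factor i of the case
    z = - xi comes from this conjugation. Scaling these rows by the first
    entries of the right eigenvectors makes their sum over j = 1, 2 equal to
    e_0 / 2 ([spectral_row_sum]), since the products r_a l_b are half of the
    entries of the two spectral projections. Multiplying by the n-th power of
    the symbol gives, for every nonzero k in (- pi, pi), the first row
    of that power as the sum over j of the integrands of the I_n(s, t; B_j),
    up to the factor 2 e^(n theta) ([walk_symbol_spectral]). This settles
    z = 1, and z = - 1 follows from the mirror symmetry (x, z) -> (- x, - z)
    of the walk ([walk_mirror]).

    Splitting the integral of that sum into the sum of the two integrals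
    requires that each of them converges, although the eigenvectors may depend
    on k in an arbitrary way. The products r_0 l_s do not: [eigenB_products]
    computes them as explicit functions of k, with the denominator
    q = sqrt(1 - cos^2 k cos^2 theta), where
    q^2 = sin^2 theta + cos^2 theta sin^2 k. Their numerators are at most q in
    absolute value, so they remain bounded even when q vanishes at k = 0,
    which happens when sin theta = 0. *)

(** * Bounded measurable complex functions and their integrals *)

(** Boundedness is kept explicit, rather than integrability, to have a class
    that is stable under products. *)
Definition bounded_measurable {R : realType} (A : set R) (f : R -> R[i]) :=
  [/\ measurable_fun A (fun k => complex.Re (f k)),
      measurable_fun A (fun k => complex.Im (f k)) &
      exists M, forall k, A k ->
        `|complex.Re (f k)| <= M /\ `|complex.Im (f k)| <= M].

Lemma eq_bounded_measurable {R : realType} {A : set R} {f g : R -> R[i]} :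
  bounded_measurable A f -> (forall k, A k -> f k = g k) ->
  bounded_measurable A g.
Proof.
move=> [mRe mIm [M fM]] fg; split.
- by apply: eq_measurable_fun mRe => k; rewrite inE => /fg ->.
- by apply: eq_measurable_fun mIm => k; rewrite inE => /fg ->.
- by exists M => k Ak; rewrite -fg//; exact: fM.
Qed.

Lemma bounded_measurable_cst {R : realType} (A : set R) (c : R[i]) :
  bounded_measurable A (fun=> c).
Proof.
split; try exact: measurable_cst.
exists (Num.max `|complex.Re c| `|complex.Im c|) => k _.
by rewrite !le_max !lexx orbT.
Qed.

Lemma bounded_measurable_real {R : realType} (A : set R) (f : R -> R) :
  measurable_fun A f -> (exists M, forall k, A k -> `|f k| <= M) ->
  bounded_measurable A (fun k => (f k)%:C).
Proof.
move=> mf [M fM]; split; [exact: mf | exact: measurable_cst |].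
exists M => k /fM /= fkM; split=> //.
by rewrite normr0; exact: le_trans fkM.
Qed.

Lemma bounded_measurableD {R : realType} {A : set R} {f g : R -> R[i]} :
  bounded_measurable A f -> bounded_measurable A g ->
  bounded_measurable A (fun k => f k + g k).
Proof.
move=> [mRf mIf [M fM]] [mRg mIg [N gN]]; split.
- apply: eq_measurable_fun (measurable_funD mRf mRg) => k _ /=.
  by case: (f k) (g k) => [? ?] [? ?].
- apply: eq_measurable_fun (measurable_funD mIf mIg) => k _ /=.
  by case: (f k) (g k) => [? ?] [? ?].
exists (M + N) => k Ak.
case: (f k) (g k) (fM k Ak) (gN k Ak) => [a b] [c d] /= [aM bM] [cN dN].
by split; apply: le_trans (ler_normD _ _) _; exact: lerD.
Qed.

Lemma bounded_measurableM {R : realType} {A : set R} {f g : R -> R[i]} :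
  bounded_measurable A f -> bounded_measurable A g ->
  bounded_measurable A (fun k => f k * g k).
Proof.
move=> [mRf mIf [M fM]] [mRg mIg [N gN]]; split.
- apply: eq_measurable_fun (measurable_funB (measurable_funM mRf mRg)
    (measurable_funM mIf mIg)) => k _ /=.
  by case: (f k) (g k) => [? ?] [? ?].
- apply: eq_measurable_fun (measurable_funD (measurable_funM mRf mIg)
    (measurable_funM mIf mRg)) => k _ /=.
  by case: (f k) (g k) => [? ?] [? ?].
exists (M * N + M * N) => k Ak.
case: (f k) (g k) (fM k Ak) (gN k Ak) => [a b] [c d] /= [aM bM] [cN dN].
split; [apply: le_trans (ler_normB _ _) _ | apply: le_trans (ler_normD _ _) _];
  by rewrite !normrM lerD// ler_pM.
Qed.

Lemma bounded_measurableX {R : realType} (A : set R) (f : R -> R[i]) n :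
  bounded_measurable A f -> bounded_measurable A (fun k => f k ^+ n).
Proof.
move=> mf; elim: n => [|n IHn].
  exact: bounded_measurable_cst.
apply: (eq_bounded_measurable (bounded_measurableM mf IHn)) => k _.
by rewrite exprS.
Qed.

Lemma bounded_measurable_sum {R : realType} (A : set R) {I : Type}
    (s : seq I) {f : I -> R -> R[i]} :
  (forall i, bounded_measurable A (f i)) ->
  bounded_measurable A (fun k => \sum_(i <- s) f i k).
Proof.
move=> mf; elim: s => [|i s IHs].
  apply: (eq_bounded_measurable (bounded_measurable_cst A 0)) => k _.
  by rewrite big_nil.
apply: (eq_bounded_measurable (bounded_measurableD (mf i) IHs)) => k _.
by rewrite big_cons.
Qed.

Lemma bounded_measurable_expi {R : realType} (A : set R) (a : R) :
  bounded_measurable A (fun k => expi (a * k)).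
Proof.
have ma : measurable_fun A (fun k : R => a * k).
  apply: measurable_funTS; apply: continuous_measurable_fun.
  by move=> k; exact: mulrl_continuous.
split => /=.
- apply: (measurableT_comp _ ma) => //.
  by apply: continuous_measurable_fun; exact: continuous_cos.
- apply: (measurableT_comp _ ma) => //.
  by apply: continuous_measurable_fun; exact: continuous_sin.
exists 1 => k _; rewrite !ler_norml.
by rewrite cos_geN1 cos_le1 sin_geN1 sin_le1.
Qed.

Lemma bounded_measurable_expiN {R : realType} (A : set R) (a : R) :
  bounded_measurable A (fun k => expi (- (k * a))).
Proof.
apply: (eq_bounded_measurable (bounded_measurable_expi A (- a))) => k _.
by rewrite mulNr mulrC.
Qed.

Section Cintegral_linear.
Context {R : realType} (A : set R).
Context (mA : measurable A) (finA : (lebesgue_measure A < +oo)%E).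

Lemma bounded_measurable_integrable (f : R -> R[i]) : bounded_measurable A f ->
  lebesgue_measure.-integrable A (fun k => (complex.Re (f k))%:E) /\
  lebesgue_measure.-integrable A (fun k => (complex.Im (f k))%:E).
Proof.
move=> [mRe mIm [M fM]].
split; apply: measurable_bounded_integrable => //;
  exists M; split; rewrite ?num_real//= => N MN k Ak;
  by have [? ?] := fM k Ak; apply/ltW; exact: le_lt_trans MN.
Qed.

Lemma CintegralD (f g : R -> R[i]) :
  bounded_measurable A f -> bounded_measurable A g ->
  Cintegral A (fun k => f k + g k) = Cintegral A f + Cintegral A g.
Proof.
move=> /bounded_measurable_integrable[Rf If].
move=> /bounded_measurable_integrable[Rg Ig].
rewrite /Cintegral; simpc; rewrite -!RintegralD//.
congr (_ +i* _); apply: eq_Rintegral => k _;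
  by case: (f k) (g k) => [? ?] [? ?].
Qed.

Lemma CintegralZl (c : R[i]) (f : R -> R[i]) : bounded_measurable A f ->
  Cintegral A (fun k => c * f k) = c * Cintegral A f.
Proof.
move=> mf; have [Rf If] := bounded_measurable_integrable _ mf.
have RfZ a :
    lebesgue_measure.-integrable A (fun k => (a * complex.Re (f k))%:E).
  have [+ _] := bounded_measurable_integrable _
    (bounded_measurableM (bounded_measurable_cst A a%:C) mf).
  apply: eq_integrable => // k _; congr EFin.
  by case: (f k) => u v /=; rewrite mul0r subr0.
have IfZ a :
    lebesgue_measure.-integrable A (fun k => (a * complex.Im (f k))%:E).
  have [_ +] := bounded_measurable_integrable _
    (bounded_measurableM (bounded_measurable_cst A a%:C) mf).
  apply: eq_integrable => // k _; congr EFin.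
  by case: (f k) => u v /=; rewrite mul0r addr0.
case: c => a b; rewrite /Cintegral; simpc.
rewrite -[- (b * _)]mulNr -!RintegralZl// -!RintegralD//.
by congr (_ +i* _); apply: eq_Rintegral => k _; case: (f k) => [? ?] /=;
  rewrite ?mulNr.
all: by [exact: RfZ | exact: IfZ].
Qed.

Lemma eq_Cintegral (f g : R -> R[i]) :
  (forall k, A k -> f k = g k) -> Cintegral A f = Cintegral A g.
Proof.
by move=> fg; congr (_ +i* _); apply: eq_Rintegral => k; rewrite inE => /fg ->.
Qed.

Lemma Cintegral_sum (I : Type) (s : seq I) {f : I -> R -> R[i]} :
  (forall i, bounded_measurable A (f i)) ->
  Cintegral A (fun k => \sum_(i <- s) f i k) = \sum_(i <- s) Cintegral A (f i).
Proof.
move=> mf; elim: s => [|i s IHs].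
  rewrite big_nil -[RHS](mul0r (Cintegral A (fun=> 0))) -CintegralZl; last first.
    exact: bounded_measurable_cst.
  by apply: eq_Cintegral => k _; rewrite big_nil mul0r.
rewrite big_cons -IHs -CintegralD//; last exact: bounded_measurable_sum.
by apply: eq_Cintegral => k _; rewrite big_cons.
Qed.

End Cintegral_linear.

(** * The walk in Fourier space *)

Lemma I2P (w : 'I_2) : w = 0 \/ w = 1.
Proof. by case: w => [[|[|//]] hw]; [left|right]; exact: val_inj. Qed.

Lemma coin_mx_rev {R : realType} (theta : R) z w :
  coin_mx theta (rev_ord z) (rev_ord w) = coin_mx theta z w.
Proof. by rewrite !mxE (inj_eq rev_ord_inj). Qed.

Lemma spin_rev z : spin (rev_ord z) = - spin z.
Proof. by case: z => [[|[|//]]]. Qed.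

Lemma walkE {R : realType} (theta : R) (psi : ell2 R) x z :
  walk theta psi (x, z) =
  \sum_(w < 2) coin_mx theta z w * psi (x - spin z, w).
Proof. by []. Qed.

(** The coin and the shift are equivariant under the reflection of both the
    position and the spin. *)
Lemma walk_mirror {R : realType} (theta : R) (xi : 'I_2) n x z :
  iter n (walk theta) (ket R 0 xi) (x, z) =
  iter n (walk theta) (ket R 0 (rev_ord xi)) (- x, rev_ord z).
Proof.
elim: n x z => [|n IHn] x z.
  by rewrite /= !xpair_eqE oppr_eq0 (inj_eq rev_ord_inj).
rewrite !iterS !walkE [RHS](reindex_inj rev_ord_inj); apply: eq_bigr => w _.
by rewrite coin_mx_rev IHn spin_rev opprD.
Qed.

Lemma expiD {R : realType} (a b : R) : expi (a + b) = expi a * expi b.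
Proof.
rewrite /expi cosD sinD; simpc.
by congr (_ +i* _); ring.
Qed.

Lemma sin_int_pi {R : realType} (x : int) : sin (x%:~R * pi) = 0 :> R.
Proof.
have sin_nat_pi n : sin (n%:R * pi) = 0 :> R.
  elim: n => [|n IHn]; first by rewrite mul0r sin0.
  by rewrite -natr1 mulrDl mul1r sinDpi IHn oppr0.
by case: x => n; rewrite ?NegzE ?mulrNz ?mulNr ?sinN sin_nat_pi ?oppr0.
Qed.

Lemma Rintegral_derive {R : realType} (a b : R) (F f : R -> R) :
  a < b -> (forall x : R, is_derive x 1 F (f x)) -> continuous f ->
  \int[lebesgue_measure]_(x in `]a, b[) f x = F b - F a.
Proof.
move=> ab dF cf.
have cF : continuous F.
  move=> x; apply/differentiable_continuous/derivable1_diffP.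
  by have [] := dF x.
have mf : measurable_fun `]a, b[ f.
  by apply: measurable_funTS; exact: continuous_measurable_fun.
rewrite /Rintegral -(@integral_itv_bndoo _ a b (EFin \o f) true false)//=.
  rewrite (@continuous_FTC2 _ f F)//.
  - exact: continuous_subspaceT.
  - split.
    + by move=> x _; have [] := dF x.
    + by apply: cvg_at_right_filter; exact: cF.
    + by apply: cvg_at_left_filter; exact: cF.
  - by move=> x _; rewrite derive1E; have [] := dF x.
exact/measurable_EFinP.
Qed.

(** Orthogonality of the characters of the circle. *)
Lemma Cintegral_expi {R : realType} (x : int) :
  Cintegral `]- pi, pi[ (fun k : R => expi (- (k * x%:~R))) =
  ((2 * pi)%:C *+ (x == 0)).
Proof.
have pi_lt : - pi < pi :> R by rewrite gtrN// pi_gt0.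
have [->|x0] := eqVneq x 0.
  rewrite /Cintegral /=.
  under eq_Rintegral do rewrite mulr0 oppr0 cos0.
  under [X in _ +i* X]eq_Rintegral do rewrite mulr0 oppr0 sin0.
  rewrite (@Rintegral_derive _ _ _ id)//; last exact: cst_continuous.
  rewrite (@Rintegral_derive _ _ _ (cst 0))//; last exact: cst_continuous.
  by rewrite /= subrr opprK mulr2n mulrDl mul1r.
set y : R := x%:~R; have y0 : y != 0 by rewrite intr_eq0.
have cy : continuous (fun k : R => - (k * y)).
  by move=> k; apply: cvgN; apply: cvgMl; exact: cvg_id.
have dy k : is_derive (k : R) (1 : R) (fun k => - (k * y)) (- y).
  by apply: is_derive_eq; rewrite scaler0 add0r /GRing.scale /= mulr1.
have ds k : is_derive (k : R) (1 : R)
    (fun k => - y^-1 * sin (- (k * y))) (cos (- (k * y))).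
  have dsy : is_derive k (1 : R) (sin \o (fun k => - (k * y)))
    (- y * cos (- (k * y))) by apply: is_derive_eq; rewrite mulrC.
  apply: (is_derive_eq (is_deriveZ (- y^-1) dsy)).
  by rewrite /GRing.scale /=; field.
have dc k : is_derive (k : R) (1 : R)
    (fun k => y^-1 * cos (- (k * y))) (sin (- (k * y))).
  have dcy : is_derive k (1 : R) (cos \o (fun k => - (k * y)))
    (- y * - sin (- (k * y))) by apply: is_derive_eq; rewrite mulrC.
  apply: (is_derive_eq (is_deriveZ (y^-1) dcy)).
  by rewrite /GRing.scale /=; field.
rewrite /Cintegral /= (Rintegral_derive _ _ _ _ pi_lt ds); last first.
  by move=> k; apply: continuous_comp; [exact: cy | exact: continuous_cos].
rewrite (Rintegral_derive _ _ _ _ pi_lt dc); last first.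
  by move=> k; apply: continuous_comp; [exact: cy | exact: continuous_sin].
rewrite !(mulNr, opprK, sinN, cosN) [pi * y]mulrC sin_int_pi.
by rewrite !(subrr, oppr0, mulr0) addr0 mulr0n.
Qed.

Definition walk_symbol {R : realType} (theta k : R) : 'M[R[i]]_2 :=
  \matrix_(z, w) (expi ((spin z)%:~R * k) * coin_mx theta z w).

Lemma bounded_measurable_symbol {R : realType} (A : set R) (theta : R) n z w :
  bounded_measurable A (fun k => (walk_symbol theta k ^+ n) z w).
Proof.
elim: n z => [|n IHn] z.
  apply: (eq_bounded_measurable
    (bounded_measurable_cst A ((1 : 'M[R[i]]_2) z w))).
  by move=> k _; rewrite expr0.
have mterm v : bounded_measurable A
    (fun k => walk_symbol theta k z v * (walk_symbol theta k ^+ n) v w).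
  apply: bounded_measurableM (IHn v).
  apply: (eq_bounded_measurable (bounded_measurableM
    (bounded_measurable_expi A (spin z)%:~R)
    (bounded_measurable_cst A (coin_mx theta z v)))) => k _.
  by rewrite [RHS]mxE.
have msum := bounded_measurable_sum A (index_enum 'I_2) mterm.
apply: (eq_bounded_measurable msum) => k _.
by rewrite exprS [RHS]mxE.
Qed.

Lemma measurable_period {R : realType} : measurable (`]- pi, pi[ : set R).
Proof. exact: measurable_itv. Qed.

Lemma finite_period {R : realType} :
  (@lebesgue_measure R `](- pi)%R, pi[%classic < +oo)%E.
Proof. by rewrite lebesgue_measure_itv/=; case: ifP => // _; rewrite ltry. Qed.

(** Inverse Fourier formula for the amplitudes: induction on n, starting from
    the orthogonality of the characters. *)
Lemma walk_Fourier {R : realType} (theta : R) (xi : 'I_2) n x z :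
  iter n (walk theta) (ket R 0 xi) (x, z) =
  ((2 * pi)^-1)%:C * Cintegral `]- pi, pi[
    (fun k => (walk_symbol theta k ^+ n) z xi * expi (- (k * x%:~R))).
Proof.
have [mA finA] := (@measurable_period R, @finite_period R).
elim: n x z => [|n IHn] x z.
  rewrite /= xpair_eqE.
  under eq_Cintegral do rewrite expr0 mxE.
  rewrite CintegralZl//; last exact: bounded_measurable_expiN.
  rewrite Cintegral_expi.
  case: (x == 0); rewrite ?mulr0n ?mulr0// mulr1n mulrCA -rmorphM mulVf ?mulr1//.
  by rewrite mulf_neq0// gt_eqF// pi_gt0.
have mIH v y : bounded_measurable `]- pi, pi[
    (fun k => (walk_symbol theta k ^+ n) v xi * expi (- (k * y))).
  by apply: bounded_measurableM; [exact: bounded_measurable_symbol|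
    exact: bounded_measurable_expiN].
(* The shift by spin z of the position becomes the factor exp(i k spin z)
   of the row z of the symbol. *)
rewrite iterS walkE.
under eq_bigr do rewrite IHn mulrCA -(CintegralZl _ mA finA _ _ (mIH _ _)).
rewrite -mulr_sumr -Cintegral_sum//; last first.
  by move=> w; exact: bounded_measurableM (bounded_measurable_cst _ _) (mIH _ _).
congr (_ * _); apply: eq_Cintegral => k _.
rewrite exprS [in RHS]mxE mulr_suml; apply: eq_bigr => w _.
rewrite [in RHS]mxE rmorphB /= mulrBr opprB addrC expiD [k * (spin z)%:~R]mulrC.
by ring.
Qed.

(** * The tilted kernel on antisymmetric vectors *)

Lemma ord4_sum (V : nmodType) (F : 'I_4 -> V) :
  \sum_(s < 4) F s = F 0 + F 1 + F 2 + F 3.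
Proof.
rewrite !big_ord_recl big_ord0 addr0 !addrA.
by congr (F _ + F _ + F _ + F _); exact: val_inj.
Qed.

Lemma spanB_antisym {R : realType} (r : 'cV[R[i]]_4) : r \in spanB R ->
  r 2 0 = - r 0 0 /\ r 3 0 = - r 1 0.
Proof.
rewrite /spanB span_cons span_seq1 => /memv_addP[u /vlineP[a ->]].
move=> [v /vlineP[b ->]] ->.
by rewrite !mxE /= !(subr0, sub0r, mulr0, mulr1, mulrN1, addr0, add0r, mulrN,
  oppr0).
Qed.

(** Only the differences p_0 - p_2 and p_1 - p_3 act on antisymmetric vectors,
    and the hyperbolic parts of the p_s cancel in them. *)
Lemma poisson4_sub02 {R : realType} (theta : R) :
  poisson4 theta 0 - poisson4 theta 2 = expR (- theta) * cos theta.
Proof. by rewrite /poisson4 /=; field. Qed.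

Lemma poisson4_sub13 {R : realType} (theta : R) :
  poisson4 theta 1 - poisson4 theta 3 = expR (- theta) * sin theta.
Proof. by rewrite /poisson4 /=; field. Qed.

Lemma tilted_kernel_right {R : realType} (theta k : R) (r : 'cV[R[i]]_4) :
  r 2 0 = - r 0 0 -> r 3 0 = - r 1 0 ->
  (tilted_kernel theta k *m r) 0 0 =
  expi k * ((expR (- theta) * cos theta)%:C * r 0 0 +
            (expR (- theta) * sin theta)%:C * r 1 0).
Proof.
move=> r2 r3; rewrite mxE ord4_sum r2 r3 !mxE !subr0 expr0 mul1r.
rewrite -poisson4_sub02 -poisson4_sub13 !rmorphB.
ring.
Qed.

Lemma tilted_kernel_left {R : realType} (theta k : R) (l : 'rV[R[i]]_4) :
  l 0 0 = - l 0 2 -> l 0 1 = - l 0 3 ->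
  (l *m tilted_kernel theta k) 0 0 =
    (expR (- theta) * cos theta)%:C * expi k * l 0 0 -
    (expR (- theta) * sin theta)%:C * expi (- k) * l 0 1 /\
  (l *m tilted_kernel theta k) 0 1 =
    (expR (- theta) * sin theta)%:C * expi k * l 0 0 +
    (expR (- theta) * cos theta)%:C * expi (- k) * l 0 1.
Proof.
move=> l2 l3; rewrite !(mxE, ord4_sum) l2 l3.
have -> : (-1 : R) ^+ (0%R : 'I_4) * k = k by rewrite mul1r.
have -> : (-1 : R) ^+ (1%R : 'I_4) * k = - k by rewrite expr1 mulN1r.
have -> : (-1 : R) ^+ (2%R : 'I_4) * k = k by rewrite sqrrN expr1n mul1r.
have -> : (-1 : R) ^+ (3%R : 'I_4) * k = - k.
  by rewrite (_ : nat_of_ord _ = 3%N)// exprS sqrrN expr1n mulr1 mulN1r.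
have -> : (0 : 'I_4) - 0 = 0 by exact: val_inj.
have -> : (0 : 'I_4) - 1 = 3 by exact: val_inj.
have -> : (0 : 'I_4) - 2 = 2 by exact: val_inj.
have -> : (0 : 'I_4) - 3 = 1 by exact: val_inj.
have -> : (1 : 'I_4) - 0 = 1 by exact: val_inj.
have -> : (1 : 'I_4) - 1 = 0 by exact: val_inj.
have -> : (1 : 'I_4) - 2 = 3 by exact: val_inj.
have -> : (1 : 'I_4) - 3 = 2 by exact: val_inj.
rewrite -poisson4_sub02 -poisson4_sub13 !rmorphB.
by split; ring.
Qed.

(** The difference of the two eigenvalues is 2 i e^(- theta) times this. *)
Definition gapB {R : realType} (theta k : R) : R :=
  Num.sqrt (1 - cos k ^+ 2 * cos theta ^+ 2).

Lemma expiE {R : realType} (k : R) : expi k = (cos k)%:C + 'i * (sin k)%:C.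
Proof. by rewrite /expi; simpc. Qed.

Lemma expiNE {R : realType} (k : R) : expi (- k) = (cos k)%:C - 'i * (sin k)%:C.
Proof. by rewrite /expi cosN sinN; simpc. Qed.

Lemma lambdaBE {R : realType} (theta : R) (j : 'I_2) (k : R) :
  lambdaB theta j k = (expR (- theta))%:C *
    ((cos k * cos theta)%:C + 'i * ((-1) ^+ j * gapB theta k)%:C).
Proof. by rewrite /lambdaB; simpc. Qed.

Lemma gapB_sqr {R : realType} (theta k : R) :
  gapB theta k ^+ 2 = sin theta ^+ 2 + (cos theta * sin k) ^+ 2.
Proof.
have [cs ck] := (cos2Dsin2 theta, cos2Dsin2 k).
rewrite sqr_sqrtr.
  by rewrite -{1}cs -{1}[cos theta ^+ 2]mulr1 -{1}ck; ring.
rewrite (_ : _ - _ = sin theta ^+ 2 + (cos theta * sin k) ^+ 2).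
  by rewrite addr_ge0 ?sqr_ge0.
by rewrite -{1}cs -{1}[cos theta ^+ 2]mulr1 -{1}ck; ring.
Qed.

Lemma gapB_gt0 {R : realType} (theta k : R) :
  - pi < k < pi -> k != 0 -> 0 < gapB theta k.
Proof.
move=> /andP[k1 k2] k0.
have sk : sin k != 0.
  have [k_lt0|k_gt0|k_eq0] := ltgtP k 0; last by rewrite k_eq0 eqxx in k0.
    rewrite -[k]opprK sinN oppr_eq0 gt_eqF// sin_gt0_pi//.
    by rewrite oppr_gt0 k_lt0 ltrNl.
  by rewrite gt_eqF// sin_gt0_pi// k_gt0.
rewrite lt0r sqrtr_ge0 andbT -sqrf_eq0 gapB_sqr paddr_eq0 ?sqr_ge0//.
rewrite !sqrf_eq0 mulf_eq0 (negbTE sk) orbF; apply/negP => /andP[/eqP s /eqP c].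
by have := cos2Dsin2 theta; rewrite s c expr0n addr0 => /esym/eqP;
  rewrite oner_eq0.
Qed.

Lemma lambdaB_neq {R : realType} (theta k : R) :
  gapB theta k != 0 -> lambdaB theta 0 k != lambdaB theta 1 k.
Proof.
move=> q0; rewrite -subr_eq0 !lambdaBE.
rewrite (_ : _ - _ = (2 * expR (- theta) * gapB theta k)%:C * 'i); last first.
  rewrite expr0 expr1 mul1r mulN1r !(rmorphM, rmorphN) /=; ring.
rewrite mulf_neq0//.
  by rewrite (fmorph_eq0 (real_complex R)) !mulf_neq0// gt_eqF// expR_gt0.
by rewrite eq_complex /= oner_eq0 andbF.
Qed.

Lemma gapB_bounds {R : realType} (theta k : R) :
  `|cos theta * sin k| <= gapB theta k /\ `|sin theta| <= gapB theta k.
Proof.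
have gap_ge0 := sqrtr_ge0 (1 - cos k ^+ 2 * cos theta ^+ 2).
by split; rewrite -ler_sqr ?nnegrE// real_normK ?num_real// gapB_sqr
  ?lerDr ?lerDl sqr_ge0.
Qed.

Lemma measurable_gapB {R : realType} (A : set R) (theta : R) :
  measurable_fun A (gapB theta).
Proof.
have mcos : measurable_fun A (@cos R).
  by apply: measurable_funTS; apply: continuous_measurable_fun;
     exact: continuous_cos.
apply: (measurableT_comp (continuous_measurable_fun (@sqrt_continuous R))).
apply: measurable_funB; first exact: measurable_cst.
by apply: measurable_funM; [exact: measurable_funX | exact: measurable_cst].
Qed.

(** A numerator dominated by the gap gives a bounded quotient, including where
    the gap vanishes, because the quotient is then 0. *)
Lemma bounded_measurable_over_gapB {R : realType} (A : set R) (theta : R)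
    (a : R -> R) :
  measurable_fun A a -> (forall k, A k -> `|a k| <= gapB theta k) ->
  bounded_measurable A (fun k => (a k / gapB theta k / 4)%:C).
Proof.
move=> ma aq; apply: bounded_measurable_real.
  apply: measurable_funM; last exact: measurable_cst.
  apply: measurable_funM => //.
  (* The inverse of the gap is measurable as its real power of exponent -1. *)
  apply: (eq_measurable_fun (fun k => gapB theta k `^ (-1))).
    by move=> k _; rewrite powR_inv1// sqrtr_ge0.
  apply: (measurableT_comp (measurable_powR _)); exact: measurable_gapB.
exists 1 => k /aq akq; rewrite normrM [`|4^-1|]ger0_norm// normrM normfV.
rewrite [`|gapB _ _|]ger0_norm ?sqrtr_ge0//.
have [->|q0] := eqVneq (gapB theta k) 0; first by rewrite invr0 mulr0 mul0r.
have : `|a k| / gapB theta k <= 1.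
  by rewrite ler_pdivrMr ?mul1r// lt0r q0 sqrtr_ge0.
lra.
Qed.

Lemma bounded_measurable_lambdaB {R : realType} (A : set R) (theta : R) j :
  bounded_measurable A (lambdaB theta j).
Proof.
have mcos : bounded_measurable A (fun k : R => (cos k * cos theta)%:C).
  apply: bounded_measurable_real.
    apply: measurable_funTS; apply: continuous_measurable_fun => k.
    by apply: cvgMl; exact: continuous_cos.
  exists 1 => k _; rewrite normrM.
  by rewrite -[leRHS]mulr1 ler_pM// ler_norml cos_le1 cos_geN1.
have mgap : bounded_measurable A (fun k : R => ((-1) ^+ j * gapB theta k)%:C).
  apply: bounded_measurable_real.
    by apply: measurable_funM; [exact: measurable_cst|exact: measurable_gapB].
  exists 1 => k _; rewrite normrM normrX normrN1 expr1n mul1r.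
  rewrite ger0_norm ?sqrtr_ge0// -[leRHS]sqrtr1 ler_wsqrtr//.
  by rewrite gerBl mulr_ge0// sqr_ge0.
have msum := bounded_measurableD mcos
  (bounded_measurableM (bounded_measurable_cst A 'i) mgap).
apply: (eq_bounded_measurable
  (bounded_measurableM (bounded_measurable_cst A (expR (- theta))%:C) msum)).
by move=> k _; rewrite lambdaBE.
Qed.

(** With B = [[b00, b01], [b10, b11]], these are the first-row entries of the
    rank-one matrix X = (u, v)^T (u', v') of trace 1/2 with BX = XB = lam X,
    which is half of the spectral projection (B - lam') / (lam - lam'), where
    lam + lam' = b00 + b11 is the trace of B. The formulas come from
    multiplying the equation for (u, v) by u' or v' and the one for (u', v')
    by v or u, and eliminating v v' with the trace. *)
Lemma rank_one_entries (F : comNzRingType) (b00 b01 b11 lam u v u' v' : F) :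
  b00 * u + b01 * v = lam * u -> b01 * u' + b11 * v' = lam * v' ->
  2 * (u * u' + v * v') = 1 ->
  2 * (2 * lam - b00 - b11) * (u * u') = lam - b11 /\
  2 * (2 * lam - b00 - b11) * (u * v') = b01.
Proof.
move=> right left one; split; apply/eqP; rewrite -subr_eq0; apply/eqP.
- have <- : - 2 * u' * (b00 * u + b01 * v - lam * u) +
     2 * v * (b01 * u' + b11 * v' - lam * v') +
     (lam - b11) * (2 * (u * u' + v * v') - 1)
   = 2 * (2 * lam - b00 - b11) * (u * u') - (lam - b11) by ring.
  by rewrite right left one !subrr !mulr0 ?subrr !addr0.
- have <- : - 2 * v' * (b00 * u + b01 * v - lam * u) -
     2 * u * (b01 * u' + b11 * v' - lam * v') +
     b01 * (2 * (u * u' + v * v') - 1)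
   = 2 * (2 * lam - b00 - b11) * (u * v') - b01 by ring.
  by rewrite right left one !subrr !mulr0 ?subrr !addr0.
Qed.

(** * Spectral decomposition of the symbol *)

Section spectral_decomposition.
Context {R : realType} (theta : R) (r : 'I_2 -> R -> 'cV[R[i]]_4)
  (l : 'I_2 -> R -> 'rV[R[i]]_4).
Context (rl : eigenvectorsB theta r l).

Lemma eigenB_equations (j : 'I_2) k : - pi < k < pi -> k != 0 ->
  [/\ expi k * ((expR (- theta) * cos theta)%:C * r j k 0 0 +
            (expR (- theta) * sin theta)%:C * r j k 1 0) =
        lambdaB theta j k * r j k 0 0,
    (expR (- theta) * cos theta)%:C * expi k * l j k 0 0 -
    (expR (- theta) * sin theta)%:C * expi (- k) * l j k 0 1 =
       lambdaB theta j k * l j k 0 0,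
    (expR (- theta) * sin theta)%:C * expi k * l j k 0 0 +
    (expR (- theta) * cos theta)%:C * expi (- k) * l j k 0 1 =
       lambdaB theta j k * l j k 0 1 &
    2 * (r j k 0 0 * l j k 0 0 + r j k 1 0 * l j k 0 1) = 1].
Proof.
move=> kpi k0; have q0 := gapB_gt0 theta k kpi k0.
have [[_ /spanB_antisym[r2 r3]] Pr [_ [l2 l3]] lP one] :=
  rl _ kpi (lambdaB_neq _ _ (lt0r_neq0 q0)) j.
have [e0 e1] := tilted_kernel_left theta k _ l2 l3.
split.
- by rewrite -tilted_kernel_right// Pr mxE.
- by rewrite -e0 lP mxE.
- by rewrite -e1 lP mxE.
- by rewrite -[RHS]one ord4_sum r2 r3 l2 l3; ring.
Qed.

(** These are the entries of half the spectral projections: whatever the choice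
    of the eigenvectors, the products are explicit functions of k. *)
Lemma eigenB_products (j : 'I_2) k : - pi < k < pi -> k != 0 ->
  r j k 0 0 * l j k 0 0 =
    4^-1 + ((-1) ^+ j * (cos theta * sin k / gapB theta k / 4))%:C /\
  r j k 0 0 * l j k 0 1 =
    - 'i * expi k * ((-1) ^+ j * (sin theta / gapB theta k / 4))%:C.
Proof.
move=> kpi k0; have q0 := lt0r_neq0 (gapB_gt0 theta k kpi k0).
have [Br lB0 lB1 one] := eigenB_equations j k kpi k0.
set K := expR (- theta) in Br lB1.
have K0 : K != 0 by rewrite gt_eqF// expR_gt0.
set b00 := expi k * (K * cos theta)%:C; set b01 := expi k * (K * sin theta)%:C.
set b11 := expi (- k) * (K * cos theta)%:C.
have right : b00 * r j k 0 0 + b01 * r j k 1 0 = lambdaB theta j k * r j k 0 0.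
  by rewrite -Br /b00 /b01; ring.
have left : b01 * l j k 0 0 + b11 * l j k 0 1 = lambdaB theta j k * l j k 0 1.
  by rewrite -lB1 /b01 /b11; ring.
have [uu uv] := rank_one_entries _ _ _ _ _ _ _ _ _ right left one.
have s1 : ((-1) ^+ j : R) != 0 by rewrite signr_eq0.
have ss : ((-1) ^+ j : R) * (-1) ^+ j = 1 by rewrite -expr2 sqrr_sign.
set s := ((-1) ^+ j : R) in s1 ss *.
set q := gapB theta k in q0 *.
have i2 : 'i * 'i = -1 :> R[i] by rewrite -expr2 sqr_i.
have trE : 2 * (2 * lambdaB theta j k - b00 - b11) = 4 * 'i * (K * s * q)%:C.
  rewrite lambdaBE -/K -/s -/q /b00 /b11 expiE expiNE !rmorphM /=; ring.
have d0 : 4 * 'i * (K * s * q)%:C != 0.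
  rewrite !mulf_neq0 ?pnatr_eq0 ?(fmorph_eq0 (real_complex R)) ?mulf_neq0//.
  by rewrite eq_complex /= oner_eq0 andbF.
rewrite trE in uu uv; split; apply: (mulfI d0).
- rewrite uu lambdaBE -/K -/s -/q /b11 expiNE.
  transitivity ('i * (K * (s * q + sin k * cos theta))%:C).
    rewrite !(rmorphM, rmorphD) /=; ring.
  transitivity ('i * (4 * (K * s * q) *
    (4^-1 + s * (cos theta * sin k / q / 4)))%:C).
    congr (_ * _%:C).
    transitivity (K * (s * q + (s * s) * (cos theta * sin k))).
      by rewrite ss mul1r [sin k * _]mulrC.
    by field.
  rewrite !(rmorphM, rmorphD, fmorphV, rmorph_nat) /=; ring.
- rewrite uv /b01.
  transitivity (- ('i * 'i) * expi k *
    (4 * (K * s * q) * (s * (sin theta / q / 4)))%:C).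
    rewrite i2 opprK mul1r; congr (_ * _%:C).
    transitivity (K * ((s * s) * sin theta)); first by rewrite ss mul1r.
    by field.
  by rewrite !(rmorphM, rmorph_nat) /=; ring.
Qed.

(** The entry r_0 (l_0, i l_1): the factor i is the conjugation by diag(1, - i)
    that relates the tilted kernel to the symbol of the walk. *)
Definition spectral_row (j : 'I_2) (k : R) : 'rV[R[i]]_2 :=
  \row_w (if w == 0 then r j k 0 0 * l j k 0 0
          else 'i * (r j k 0 0 * l j k 0 1)).

Lemma spectral_row_eigen (j : 'I_2) k : - pi < k < pi -> k != 0 ->
  spectral_row j k *m walk_symbol theta k =
  ((expR theta)%:C * lambdaB theta j k) *: spectral_row j k.
Proof.
move=> kpi k0.
have [_ lB0 lB1 _] := eigenB_equations j k kpi k0.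
have eK : (expR theta)%:C * (expR (- theta))%:C = 1 :> R[i].
  by rewrite -rmorphM -expRD subrr expR0.
have i2 : 'i * 'i = -1 :> R[i] by rewrite -expr2 sqr_i.
have iC : (0 +i* sin theta) = 'i * (sin theta)%:C by simpc.
have a0 : (spin 0)%:~R * k = k by rewrite mul1r.
have a1 : (spin 1)%:~R * k = - k by rewrite /spin expr1 mulrNz mulN1r.
apply/rowP => w; rewrite !mxE big_ord_recl big_ord1.
rewrite (_ : lift _ _ = 1); last exact: val_inj.
rewrite !mxE /= a0 a1 iC.
case: (I2P w) => -> /=.
- transitivity ((expR theta)%:C * r j k 0 0 * (lambdaB theta j k * l j k 0 0));
    last by ring.
  rewrite -lB0 !rmorphM /=.
  transitivity ((expR theta)%:C * (expR (- theta))%:C * r j k 0 0 *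
    ((cos theta)%:C * expi k * l j k 0 0 +
     'i * 'i * ((sin theta)%:C * expi (- k) * l j k 0 1))).
    by rewrite eK; ring.
  by rewrite i2; ring.
- transitivity ((expR theta)%:C * 'i * r j k 0 0 *
    (lambdaB theta j k * l j k 0 1)); last by ring.
  rewrite -lB1 !rmorphM /=.
  transitivity ((expR theta)%:C * (expR (- theta))%:C * ('i * r j k 0 0 *
    ((sin theta)%:C * expi k * l j k 0 0 +
     (cos theta)%:C * expi (- k) * l j k 0 1))); last by ring.
  by rewrite eK; ring.
Qed.

(** The two spectral projections sum to the identity, and the rows are half of
    their first rows. *)
Lemma spectral_row_sum k : - pi < k < pi -> k != 0 ->
  2 *: \sum_j spectral_row j k = delta_mx 0 0.
Proof.
move=> kpi k0.
have [p00 p01] := eigenB_products 0 k kpi k0.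
have [p10 p11] := eigenB_products 1 k kpi k0.
apply/rowP => w; rewrite big_ord_recl big_ord1.
rewrite (_ : lift _ _ = 1); last exact: val_inj.
rewrite !mxE p00 p01 p10 p11 expr0 expr1 !mul1r !mulN1r !rmorphN.
case: (I2P w) => -> /=; move: (real_complex R _) => X; last by ring.
by rewrite mulr1n; field.
Qed.

Lemma walk_symbol_spectral n k w : - pi < k < pi -> k != 0 ->
  (walk_symbol theta k ^+ n) 0 w =
  \sum_j 2 * ((expR theta)%:C * lambdaB theta j k) ^+ n * spectral_row j k 0 w.
Proof.
move=> kpi k0.
have pow j : spectral_row j k *m (walk_symbol theta k ^+ n) =
    ((expR theta)%:C * lambdaB theta j k) ^+ n *: spectral_row j k.
  elim: n => [|n IHn]; first by rewrite expr0 scale1r mulmx1.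
  by rewrite exprS mulmxA spectral_row_eigen// -scalemxAl IHn scalerA exprS.
transitivity (((delta_mx 0 0 : 'rV[R[i]]_2) *m (walk_symbol theta k ^+ n)) 0 w).
  by rewrite -rowE mxE.
rewrite -(spectral_row_sum k)// -scalemxAl mulmx_suml mxE summxE mulr_sumr.
by apply: eq_bigr => j _; rewrite pow mxE mulrA.
Qed.

(** In (- pi, pi), the point 0 is the only one where the two
    eigenvalues may coincide. *)
Definition punctured_period : set R := `]- pi, pi[ `\ 0.

Lemma punctured_periodP k : punctured_period k -> - pi < k < pi /\ k != 0.
Proof. by rewrite /punctured_period/= in_itv/= => -[? /eqP]. Qed.

Lemma bounded_measurable_spectral_row (j w : 'I_2) :
  bounded_measurable punctured_period (fun k => spectral_row j k 0 w).
Proof.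
case: (I2P w) => ->.
- have m := bounded_measurableM (bounded_measurable_cst _ ((-1) ^+ j)%:C)
    (bounded_measurable_over_gapB punctured_period theta
       (fun k => cos theta * sin k) _
       (fun k _ => (gapB_bounds theta k).1)).
  apply: (eq_bounded_measurable
    (bounded_measurableD (bounded_measurable_cst _ 4^-1) (m _))).
    apply: measurable_funTS; apply: continuous_measurable_fun => k.
    by apply: cvgMr; exact: continuous_sin.
  move=> k /punctured_periodP[kpi k0].
  by rewrite mxE/= (eigenB_products j k kpi k0).1 -rmorphM.
- have m := bounded_measurableM (bounded_measurable_expi punctured_period 1)
    (bounded_measurableM (bounded_measurable_cst _ ((-1) ^+ j)%:C)
    (bounded_measurable_over_gapB punctured_period theta (fun k => sin theta)
      (measurable_cst _) (fun k _ => (gapB_bounds theta k).2))).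
  apply: (eq_bounded_measurable m) => k /punctured_periodP[kpi k0].
  rewrite mxE/= (eigenB_products j k kpi k0).2 -rmorphM mul1r.
  by rewrite !mulrA mulrN -expr2 sqr_i opprK mul1r.
Qed.

Lemma Cintegral_punctured_period (f : R -> R[i]) :
  bounded_measurable punctured_period f ->
  Cintegral `]- pi, pi[ f = Cintegral punctured_period f.
Proof.
have m0 : measurable punctured_period by exact: measurableD.
move=> [mRe mIm _]; congr (_ +i* _); rewrite /Rintegral.
  by rewrite -(integral_setD1 m0)//; exact/measurable_EFinP.
by rewrite -(integral_setD1 m0)//; exact/measurable_EFinP.
Qed.

(** Each spectral row is proportional to the integrand of one I_B, so the
    integral of the spectral decomposition splits into the integrals I_B. *)
Lemma Fourier_coefficient_I_B n (t : int) (w : 'I_2) (s : 'I_4) (phase : R[i]) :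
  phase != 0 ->
  (forall j k, spectral_row j k 0 w = phase * (r j k 0 0 * l j k 0 s)) ->
  ((2 * pi)^-1)%:C * Cintegral `]- pi, pi[
    (fun k => (walk_symbol theta k ^+ n) 0 w * expi (- (k * t%:~R))) =
  phase * 2 * (expR (n%:R * theta))%:C * \sum_(j < 2) I_B theta r l n s t j.
Proof.
move=> phase0 rowE.
pose f j k := r j k 0 0 * l j k 0 s * lambdaB theta j k ^+ n *
  expi (- (k * t%:~R)).
have m0 : measurable punctured_period.
  by apply: measurableD => //; exact: measurable_period.
have fin0 : (lebesgue_measure punctured_period < +oo)%E.
  apply: le_lt_trans (@finite_period R); apply: le_measure; rewrite ?inE//.
  by move=> k [].
have mf j : bounded_measurable punctured_period (f j).
  apply: (eq_bounded_measurable (bounded_measurableM (bounded_measurableM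
    (bounded_measurableM (bounded_measurable_cst _ phase^-1)
      (bounded_measurable_spectral_row j w))
    (bounded_measurableX _ _ n (bounded_measurable_lambdaB _ theta j)))
    (bounded_measurable_expiN _ _))).
  by move=> k _; rewrite rowE mulKf.
set c := phase * 2 * (expR (n%:R * theta))%:C.
have -> : \sum_(j < 2) I_B theta r l n s t j =
    ((2 * pi)^-1)%:C * \sum_(j < 2) Cintegral punctured_period (f j).
  rewrite mulr_sumr; apply: eq_bigr => j _.
  by rewrite -Cintegral_punctured_period.
have msum := bounded_measurable_sum _ (index_enum 'I_2) mf.
rewrite mulrCA -Cintegral_sum// -(CintegralZl _ m0 fin0 c _ msum).
rewrite Cintegral_punctured_period; last first.
  apply: bounded_measurableM; first exact: bounded_measurable_symbol.
  exact: bounded_measurable_expiN.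
congr (_ * _); apply: eq_Cintegral => k /punctured_periodP[kpi k0].
rewrite walk_symbol_spectral// mulr_suml mulr_sumr; apply: eq_bigr => j _.
rewrite rowE exprMn -rmorphXn /= -expRM_natl /f /c; ring.
Qed.

End spectral_decomposition.

Theorem theorem3p3 (R : realType) (theta : R) (xi : 'I_2)
    (r : 'I_2 -> R -> 'cV[R[i]]_4) (l : 'I_2 -> R -> 'rV[R[i]]_4)
    (htheta : 0 < theta < 2 * pi)
    (hrl : eigenvectorsB theta r l)
    (n : nat) (hn : (1 <= n)%N) (x : int) (z : 'I_2) :
  iter n (walk theta) (ket R 0 xi) (x, z) =
  if z == xi then
    2 * (expR (n%:R * theta))%:C *
    \sum_(j < 2) I_B theta r l n 0 (x * spin z) j
  else
    2 * 'i%C * (expR (n%:R * theta))%:C *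
    \sum_(j < 2) I_B theta r l n 1 (x * spin z) j.
Proof.
have spin_up xi' y : iter n (walk theta) (ket R 0 xi') (y, 0) =
    if 0 == xi' then
      2 * (expR (n%:R * theta))%:C * \sum_(j < 2) I_B theta r l n 0 y j
    else
      2 * 'i%C * (expR (n%:R * theta))%:C * \sum_(j < 2) I_B theta r l n 1 y j.
  rewrite walk_Fourier; case: (I2P xi') => -> /=.
  - rewrite (Fourier_coefficient_I_B _ _ _ hrl _ _ _ 0 1) ?oner_neq0 ?mul1r//.
    by move=> j k; rewrite mxE mul1r.
  - rewrite (Fourier_coefficient_I_B _ _ _ hrl _ _ _ 1 'i).
    + by rewrite ['i * 2]mulrC.
    + by rewrite eq_complex /= oner_eq0 andbF.
    + by move=> j k; rewrite mxE.
(* The reflection exchanges the two spins and changes x into - x. *)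
case: (I2P z) => ->; first by rewrite spin_up mulr1.
rewrite walk_mirror (_ : rev_ord 1 = 0); last exact: val_inj.
rewrite spin_up (_ : x * spin 1 = - x); last by rewrite /spin expr1 mulrN1.
by case: (I2P xi) => ->.
Qed.
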